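(* Let $C\subseteq\mathbb{R}^q$ be a polyhedral convex cone containing no lines, given by a matrix $Y\in\mathbb{R}^{q\times o}$ as $C=\{Yv : v\in\mathbb{R}^o,\ v\ge 0\}$, and let $c\in\operatorname{int} C$ with $c_q\neq 0$. Consider the vector linear maximization problem $$\max\nolimits_C\ Px\quad\text{subject to}\quad a\le Bx\le b,\quad l\le x\le s,$$ with $P\in\mathbb{R}^{q\times n}$, $B\in\mathbb{R}^{m\times n}$, $a\in(\mathbb{R}\cup\{-\infty\})^m$, $b\in(\mathbb{R}\cup\{+\infty\})^m$, $l\in(\mathbb{R}\cup\{-\infty\})^n$, $s\in(\mathbb{R}\cup\{+\infty\})^n$, and let $\mathcal{P}$ be its lower image. Let $\mathcal{D}$ be the upper image of the dual problem (both defined in the context). Define $$\varphi(y,y^* ) := -c_q\sum_{i=1}^{q-1} y_i y_i^* - y_q\Bigl(\frac{|c_q|}{c_q}-\sum_{i=1}^{q-1} c_i y_i^*\Bigr)+\xi(y)\,|c_q|\,y_q^*,$$ where $\xi(y)=1$ if $y$ is a point and $\xi(y)=0$ if $y$ is a direction. If $\mathcal{P}$ has a vertex, then the following hold. (i) A finite set $\bar Y$ of points and directions in $\mathbb{R}^q$ is an irredundant V-representation of $\mathcal{P}$ if and only if the system of inequalities (in the variable $y^*\in\mathbb{R}^q$) $\varphi(y,y^* )\ge 0$, $y\in\bar Y$, is an irredundant H-representation of $\mathcal{D}$. (ii) A finite set $\bar W$ of points in $\mathbb{R}^q$ combined with the direction $(0,\dots,0,1)^T$ forms an irredundant V-representation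 of $\mathcal{D}$ if and only if the system of inequalities (in the variable point $y\in\mathbb{R}^q$, so $\xi(y)=1$) $\varphi(y,y^* )\ge 0$, $y^*\in\bar W$, is an irredundant H-representation of $\mathcal{P}$.
   Context: Here $n,m,q,o$ are positive integers. Inequalities between vectors are componentwise. The ordering is $y\le_C z :\iff z-y\in C$, and $\max_C$ means maximization with respect to $\le_C$. Lower image: with feasible set $S=\{x\in\mathbb{R}^n : a\le Bx\le b,\ l\le x\le s\}$, the lower image is $\mathcal{P}:=P[S]-C=\{Px-k : x\in S,\ k\in C\}$. Dual problem: let $K:=\{y\in\mathbb{R}^q : y_1=\dots=y_{q-1}=0,\ y_q\ge 0\}$. The dual problem is to $K$-minimize $D(u,w,v)$ subject to $$B^Tu=P^Tw+v,\quad Y^Tw\ge 0,\quad c^Tw=1,$$ over $(u,w,v)\in\mathbb{R}^m\times\mathbb{R}^q\times\mathbb{R}^n$, where $$D(u,w,v)=\Bigl(\tfrac{c_q}{|c_q|}w_1,\dots,\tfrac{c_q}{|c_q|}w_{q-1},\,\bar d(u,v)\Bigr)^T,\qquad \bar d(u,v)=b^Tu^+-a^Tu^-+s^Tv^--l^Tv^+.$$ Here $\alpha^+=\max(0,\alpha)$ and $\alpha^-=\max(-\alpha,0)$ for real $\alpha$, applied componentwise to vectors, and $\pm\infty\cdot 0=0$. A dual variable component ($u_i^+$, $u_i^-$, $v_j^-$ or $v_j^+$) multiplied by an infinite entry of $a,b,l,s$ must vanish; that is, the dual feasible set $T$ consists of those $(u,w,v)$ satisfying the constraints above for which $\bar d(u,v)$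 is finite. The upper image of the dual problem is $\mathcal{D}:=D[T]+K$. A V-representation of a polyhedron $Q\subseteq\mathbb{R}^q$ is a finite set of points and directions (each element carrying the tag ''point'' or ''direction'') such that $Q$ equals the convex hull of the points plus the convex cone generated by the directions. An H-representation of $Q$ is a finite system of affine inequalities whose solution set is $Q$. A representation is irredundant if no element (point, direction, or inequality) can be omitted without the result ceasing to represent $Q$.
   Formalization: Part (i) is stated only for q ≥ 2: for q = 1 the lower image is a half-line whose irredundant V-representation contains a direction, which yields a trivial inequality (1 ≥ 0), so the system is redundant and (i) fails; part (ii) is for all q ≥ 1. *)

(* Defs.v *)
From mathcomp Require Export all_boot all_order all_algebra.
From mathcomp Require Export all_classical all_reals all_analysis.
Export Order.TTheory GRing.Theory Num.Theory.
Export numFieldNormedType.Exports.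

Set Implicit Arguments.
Unset Strict Implicit.
Unset Printing Implicit Defensive.

Local Open Scope classical_set_scope.
Local Open Scope ring_scope.

(* Vectors are columns.  A positive dimension is written d.+1, so that the    *)
(* last coordinate of y : 'cV[R]_q.+1 is y ord_max 0 and the other ones are   *)
(* the y i 0 with i != ord_max.                                               *)

Definition nonneg_vec (R : realType) d (x : 'cV[R]_d) : Prop :=
  forall i, 0 <= x i 0.

Definition cone_of (R : realType) q o (Y : 'M[R]_(q, o)) : set 'cV[R]_q :=
  [set Y *m v | v in @nonneg_vec R o].

Definition contains_no_line (R : realType) q (A : set 'cV[R]_q) : Prop :=
  ~ exists x d : 'cV[R]_q, d != 0 /\ forall t : R, A (x + t *: d).

Definition is_vertex (R : realType) q (Q : set 'cV[R]_q) (x : 'cV[R]_q) : Prop :=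
  Q x /\ forall (y z : 'cV[R]_q) (t : R), Q y -> Q z -> 0 < t < 1 ->
    x = t *: y + (1 - t) *: z -> y = x /\ z = x.

Definition primal_feasible (R : realType) m n (B : 'M[R]_(m, n))
    (a b : 'cV[\bar R]_m) (l s : 'cV[\bar R]_n) : set 'cV[R]_n :=
  [set x | (forall i, (a i ord0 <= ((B *m x) i ord0)%:E <= b i ord0)%E) /\
           (forall j, (l j ord0 <= (x j ord0)%:E <= s j ord0)%E)].

Definition lower_image (R : realType) m n q (P : 'M[R]_(q, n))
    (B : 'M[R]_(m, n)) (a b : 'cV[\bar R]_m) (l s : 'cV[\bar R]_n)
    (C : set 'cV[R]_q) : set 'cV[R]_q :=
  [set P *m x - k | x in primal_feasible B a b l s & k in C].

Definition pos_part (R : realType) d (x : 'cV[R]_d) : 'cV[R]_d :=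
  map_mx (fun t => Num.max 0 t) x.

Definition neg_part (R : realType) d (x : 'cV[R]_d) : 'cV[R]_d :=
  map_mx (fun t => Num.max (- t) 0) x.

Definition edot (R : realType) d (x : 'cV[\bar R]_d) (y : 'cV[R]_d) : \bar R :=
  (\sum_i x i ord0 * (y i ord0)%:E)%E.

(* The library's product satisfies +oo * 0 = -oo * 0 = 0.  When a and l avoid *)
(* +oo and b and s avoid -oo, the four terms avoid -oo, so this sum never     *)
(* involves +oo - +oo, and it is finite iff all its products are.             *)
Definition dual_cost (R : realType) m n (a b : 'cV[\bar R]_m)
    (l s : 'cV[\bar R]_n) (u : 'cV[R]_m) (v : 'cV[R]_n) : \bar R :=
  (edot b (pos_part u) - edot a (neg_part u)
   + edot s (neg_part v) - edot l (pos_part v))%E.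

Definition dual_feasible (R : realType) m n q o (P : 'M[R]_(q, n))
    (B : 'M[R]_(m, n)) (a b : 'cV[\bar R]_m) (l s : 'cV[\bar R]_n)
    (Y : 'M[R]_(q, o)) (c : 'cV[R]_q) :
    set ('cV[R]_m * 'cV[R]_q * 'cV[R]_n) :=
  [set p | let: (u, w, v) := p in
    [/\ B^T *m u = P^T *m w + v,
        nonneg_vec (Y^T *m w),
        (c^T *m w) 0 0 = 1
      & dual_cost a b l s u v \is a fin_num]].

Definition dual_objective (R : realType) m n q (a b : 'cV[\bar R]_m)
    (l s : 'cV[\bar R]_n) (c : 'cV[R]_q.+1)
    (p : 'cV[R]_m * 'cV[R]_q.+1 * 'cV[R]_n) : 'cV[R]_q.+1 :=
  let: (u, w, v) := p in
  \col_i if i == ord_max then fine (dual_cost a b l s u v)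
         else c ord_max 0 / `|c ord_max 0| * w i 0.

Definition dual_cone (R : realType) q : set 'cV[R]_q.+1 :=
  [set y | (forall i, i != ord_max -> y i 0 = 0) /\ 0 <= y ord_max 0].

Definition upper_image (R : realType) m n q o (P : 'M[R]_(q.+1, n))
    (B : 'M[R]_(m, n)) (a b : 'cV[\bar R]_m) (l s : 'cV[\bar R]_n)
    (Y : 'M[R]_(q.+1, o)) (c : 'cV[R]_q.+1) : set 'cV[R]_q.+1 :=
  [set dual_objective a b l s c p + k
     | p in dual_feasible P B a b l s Y c & k in @dual_cone R q].

Inductive generator (V : Type) : Type :=
  | Point of V
  | Direction of V.

Definition gval V (g : generator V) : V :=
  match g with Point y => y | Direction y => y end.

Definition xi (R : realType) V (g : generator V) : R :=
  match g with Point _ => 1 | Direction _ => 0 end.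

Definition convex_hull (R : realType) q (A : set 'cV[R]_q) : set 'cV[R]_q :=
  [set x | exists (k : nat) (p : 'I_k -> 'cV[R]_q) (t : 'I_k -> R),
     [/\ forall i, A (p i), forall i, 0 <= t i, \sum_i t i = 1
       & x = \sum_i t i *: p i]].

(* The empty sum is allowed: the cone generated by the empty set is {0}.      *)
Definition conic_hull (R : realType) q (A : set 'cV[R]_q) : set 'cV[R]_q :=
  [set x | exists (k : nat) (p : 'I_k -> 'cV[R]_q) (t : 'I_k -> R),
     [/\ forall i, A (p i), forall i, 0 <= t i & x = \sum_i t i *: p i]].

Definition Vrep (R : realType) q (G : set (generator 'cV[R]_q))
    (Q : set 'cV[R]_q) : Prop :=
  finite_set G /\
  Q = [set x + d | x in convex_hull [set y | G (Point y)]
                 & d in conic_hull [set y | G (Direction y)]].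

Definition irredundant_Vrep (R : realType) q (G : set (generator 'cV[R]_q))
    (Q : set 'cV[R]_q) : Prop :=
  Vrep G Q /\ forall g, G g -> ~ Vrep (G `\ g) Q.

Definition affine_fun (R : realType) q (f : 'cV[R]_q -> R) : Prop :=
  exists (h : 'cV[R]_q) (r : R), forall z, f z = (h^T *m z) 0 0 + r.

(* The system of inequalities 0 <= f i z, for i in I, in the unknown z.       *)
Definition Hrep (R : realType) q (J : Type) (I : set J)
    (f : J -> 'cV[R]_q -> R) (Q : set 'cV[R]_q) : Prop :=
  [/\ finite_set I, forall i, I i -> affine_fun (f i)
    & Q = [set z | forall i, I i -> 0 <= f i z]].

Definition irredundant_Hrep (R : realType) q (J : Type) (I : set J)
    (f : J -> 'cV[R]_q -> R) (Q : set 'cV[R]_q) : Prop :=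
  Hrep I f Q /\ forall i, I i -> ~ Hrep (I `\ i) f Q.

Definition phi (R : realType) q (c : 'cV[R]_q.+1)
    (g : generator 'cV[R]_q.+1) (ys : 'cV[R]_q.+1) : R :=
  let y := gval g in
  let cq := c ord_max 0 in
  - cq * (\sum_(i | i != ord_max) y i 0 * ys i 0)
  - y ord_max 0 * (`|cq| / cq - \sum_(i | i != ord_max) c i 0 * ys i 0)
  + xi R g * `|cq| * ys ord_max 0.

(* Main.v *)
(* Write [normal ys] for the affine lift of the first [q] coordinates of [ys]
   to the hyperplane [dot c w = 1].  Up to the factor [|c_q|],
   [phi c g ys] is [xi g * ys_q - dot (normal ys) y], so LP duality says that
   the upper image is the set of [ys] for which [dot (normal ys) y <= ys_q] is
   valid on the lower image, i.e. a slice of the polar of its homogenization,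
   and separation recovers the lower image from this slice.  A finite set
   generates a cone iff it describes the polar cone (Farkas), and passing to
   the slice loses nothing because the lower image has a vertex: hence
   V-representations of one image are H-representations of the other for
   arbitrary finite sets, and irredundancy is carried along. *)
Require Import Defs.
From mathcomp Require Import ring lra.

Set Implicit Arguments.
Unset Strict Implicit.
Unset Printing Implicit Defensive.

Local Open Scope classical_set_scope.
Local Open Scope ring_scope.

(** * Linear forms and Farkas' lemma *)

Section LinearForms.
Variables (R : pzRingType) (V : lmodType R) (f : V -> R).
Hypothesis lin_f : scalar f.

Lemma scalar_formD x y : f (x + y) = f x + f y.
Proof. by rewrite -{1}[x]scale1r lin_f mul1r. Qed.

Lemma scalar_form0 : f 0 = 0.
Proof. by apply: (@addrI _ (f 0)); rewrite -scalar_formD !addr0. Qed.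

Lemma scalar_formZ t x : f (t *: x) = t * f x.
Proof. by rewrite -[t *: x]addr0 lin_f scalar_form0 addr0. Qed.

Lemma scalar_formN x : f (- x) = - f x.
Proof. by rewrite -scaleN1r scalar_formZ mulN1r. Qed.

End LinearForms.

Section Farkas.
Variables (R : realFieldType).

(* Bartl's proof: if [x] violates the implication once the constraint [f 0]
   is dropped, then [f 0 x > 0], and the induction hypothesis applies after
   projecting along [x] onto the kernel of [f 0]. *)
Lemma farkas_ord (V : lmodType R) n (f : 'I_n -> V -> R) (g : V -> R) :
  (forall i, scalar (f i)) -> scalar g ->
  (forall x, (forall i, f i x <= 0) -> g x <= 0) ->
  exists2 w : 'I_n -> R, (forall i, 0 <= w i) &
    forall x, g x = \sum_i w i * f i x.
Proof.
elim: n f g => [|n IHn] f g lin_f lin_g fg.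
  (* Without constraints, [g <= 0] holds at both [x] and [-x], so [g] vanishes. *)
  exists (fun=> 0) => // x; rewrite big_ord0; apply/le_anti.
  by rewrite fg => [/=|[]//]; rewrite -oppr_le0 -scalar_formN ?fg// => -[].
pose f' i := f (lift ord0 i).
have lin_f' i : scalar (f' i) by exact: lin_f.
have [fg'|/existsNP[x /not_implyP[fx /negP]]] :=
    pselect (forall x, (forall i, f' i x <= 0) -> g x <= 0).
  have [w w0 gE] := IHn f' g lin_f' lin_g fg'.
  exists (fun i => if unlift ord0 i is Some j then w j else 0).
    by move=> i; case: unlift.
  move=> x; rewrite big_ord_recl unlift_none mul0r add0r gE.
  by apply: eq_bigr => i _; rewrite liftK.
rewrite -ltNge => gx.
have f0x : 0 < f ord0 x.
  rewrite ltNge; apply/negP => f0x; move: gx; apply/negP; rewrite -leNgt.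
  by apply: fg => i; case: (unliftP ord0 i) => [j|] ->; [exact: fx|].
pose p z := z - (f ord0 z / f ord0 x) *: x.
have lin_p t y z : p (t *: y + z) = t *: p y + p z.
  rewrite /p lin_f scalerBr scalerA mulrDl scalerDl opprD mulrA.
  by rewrite addrACA.
have f0p z : f ord0 (p z) = 0.
  rewrite /p scalar_formD// scalar_formN// scalar_formZ//.
  by rewrite divfK ?subrr// gt_eqF.
have [w w0 gE] : exists2 w : 'I_n -> R, (forall i, 0 <= w i) &
    forall z, g (p z) = \sum_i w i * f' i (p z).
  apply: (IHn (fun i => f' i \o p) (g \o p)).
  - by move=> i t y z /=; rewrite lin_p lin_f'.
  - by move=> t y z /=; rewrite lin_p lin_g.
  - move=> z /= fz; apply: fg => i.
    by case: (unliftP ord0 i) => [j|] ->; [exact: fz|rewrite f0p].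
(* The weight of [f ord0] is forced by the identity at [x]; it is nonnegative since [g x > 0] while
   every [f' i x <= 0]. *)
pose w00 := (g x - \sum_i w i * f' i x) / f ord0 x.
exists (fun i => if unlift ord0 i is Some j then w j else w00).
  move=> i; case: unlift => [j|]; first exact: w0.
  apply: divr_ge0; last exact: ltW.
  rewrite subr_ge0 (le_trans _ (ltW gx))//.
  by apply: sumr_le0 => j _; rewrite mulr_ge0_le0.
move=> z; rewrite big_ord_recl unlift_none.
have -> : \sum_(i < n)
    (if unlift ord0 (lift ord0 i) is Some j then w j else w00) * f (lift ord0 i) z =
    \sum_i w i * f' i z.
  by apply: eq_bigr => i _; rewrite liftK.
have := gE z; rewrite {1}/p scalar_formD// scalar_formN// scalar_formZ//.
have -> : \sum_i w i * f' i (p z) = \sum_i w i * f' i z -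
    (f ord0 z / f ord0 x) * \sum_i w i * f' i x.
  rewrite mulr_sumr -sumrB; apply: eq_bigr => i _.
  by rewrite /p scalar_formD// scalar_formN// scalar_formZ//; ring.
move=> /(canRL (subrK _)) ->; rewrite /w00.
by field; rewrite gt_eqF.
Qed.

Lemma farkas (V : lmodType R) (I : finType) (f : I -> V -> R) (g : V -> R) :
  (forall i, scalar (f i)) -> scalar g ->
  (forall x, (forall i, f i x <= 0) -> g x <= 0) ->
  exists2 w : I -> R, (forall i, 0 <= w i) &
    forall x, g x = \sum_i w i * f i x.
Proof.
move=> lin_f lin_g fg.
have [||w w0 gE] := @farkas_ord V #|I| (fun k => f (enum_val k)) g _ lin_g.
- by move=> k; exact: lin_f.
- by move=> x fx; apply: fg => i; rewrite -(enum_rankK i).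
exists (fun i => w (enum_rank i)) => [i //|x].
rewrite gE [RHS](reindex (@enum_val I I))/=; last first.
  by exists enum_rank => i _; [rewrite enum_valK|rewrite enum_rankK].
by apply: eq_bigr => i _; rewrite enum_valK.
Qed.

Lemma scalar_pair (V : lmodType R) (f : V -> R) (b : R) : scalar f ->
  scalar (fun z : V * R^o => f z.1 - b * z.2).
Proof.
by move=> lin_f t x y /=; rewrite lin_f /GRing.scale/=; ring.
Qed.

(** Homogenization: the forms [f i x - b i * t], with the extra constraint [t >= 0] indexed by
    [inr tt], reduce the affine case to [farkas] on [V * R]. *)
Lemma affine_farkas (V : lmodType R) (I : finType) (f : I -> V -> R)
    (b : I -> R) (g : V -> R) (r : R) (x0 : V) :
  (forall i, scalar (f i)) -> scalar g -> (forall i, f i x0 <= b i) ->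
  (forall x, (forall i, f i x <= b i) -> g x <= r) ->
  exists w : I -> R, [/\ forall i, 0 <= w i,
    forall x, g x = \sum_i w i * f i x & \sum_i w i * b i <= r].
Proof.
move=> lin_f lin_g fx0 fg.
pose F (k : I + unit) (z : V * R^o) :=
  match k with inl i => f i z.1 - b i * z.2 | inr _ => 0 - 1 * z.2 end.
have [|||w w0 gE] := @farkas (V * R^o)%type (I + unit)%type F
    (fun z => g z.1 - r * z.2).
- case=> [i|[]]; first exact: scalar_pair.
  by apply: (@scalar_pair V (fun=> 0)) => t x y; rewrite mulr0 addr0.
- exact: scalar_pair.
- move=> [x t] Fx /=; have := Fx (inr tt); rewrite /= mul1r sub0r oppr_le0.
  have {}Fx i : f i x <= b i * t by rewrite -subr_le0; exact: (Fx (inl i)).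
  rewrite le_eqVlt => /predU1P[t0|t0].
    (* Here [x] is a recession direction: if [g x > 0], a step of length [e] from the feasible [x0]
       would push [g] above [r]. *)
    subst t; rewrite mulr0 subr0 leNgt; apply/negP => gx.
    pose e := (`|r - g x0| + 1) / g x.
    have e0 : 0 <= e by rewrite divr_ge0// ?addr_ge0// ltW.
    have : g (x0 + e *: x) <= r.
      apply: fg => i; rewrite scalar_formD// scalar_formZ//.
      by rewrite -[leRHS]addr0 lerD// mulr_ge0_le0// (le_trans (Fx i))// mulr0.
    rewrite scalar_formD// scalar_formZ// /e divfK ?gt_eqF//.
    by have := ler_norm (r - g x0); lra.
  have : g (t^-1 *: x) <= r.
    apply: fg => i; rewrite scalar_formZ// mulrC ler_pdivrMr//.
  by rewrite scalar_formZ// mulrC ler_pdivrMr// subr_le0.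
exists (w \o inl); split=> [i|x|]/=; first exact: w0.
  have := gE (x, 0); rewrite /= mulr0 subr0 big_sumType/= => ->.
  rewrite [X in _ + X]big1 ?addr0 => [|i _]; last by rewrite mulr0 subrr mulr0.
  by apply: eq_bigr => i _; rewrite mulr0 subr0.
have := gE (0, 1); rewrite /= scalar_form0// mulr1 sub0r big_sumType/=.
have -> : \sum_(i : unit) w (inr i) * (0 - 1 * 1) = - \sum_(i : unit) w (inr i).
  by rewrite -sumrN; apply: eq_bigr => i _; ring.
have -> : \sum_i w (inl i) * (f i 0 - b i * 1) = - \sum_i w (inl i) * b i.
  by rewrite -sumrN; apply: eq_bigr => i _; rewrite scalar_form0//; ring.
have : 0 <= \sum_(i : unit) w (inr i) by apply: sumr_ge0 => i _; exact: w0.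
by lra.
Qed.

(** Infeasibility forces [t <= 0] in the homogenized system, so the form sending [(x, t)] to [t] is
    a nonnegative combination of its forms. Evaluation at [(x, 0)] and [(0, 1)] yields the
    certificate, the last sum being [-1]. *)
Lemma farkas_infeasible (V : lmodType R) (I : finType) (f : I -> V -> R)
    (b : I -> R) :
  (forall i, scalar (f i)) -> ~ (exists x, forall i, f i x <= b i) ->
  exists w : I -> R, [/\ forall i, 0 <= w i,
    forall x, \sum_i w i * f i x = 0 & \sum_i w i * b i < 0].
Proof.
move=> lin_f infeas.
have lin0 : scalar ((fun=> 0) : V -> R) by move=> t x y; rewrite mulr0 addr0.
have [|||w w0 gE] := @farkas (V * R^o)%type I (fun i z => f i z.1 - b i * z.2)
    (fun z => 0 - (- 1) * z.2).
- by move=> i; exact: scalar_pair.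
- exact: (@scalar_pair V (fun=> 0)).
- move=> [x t] /= Fx; rewrite mulN1r sub0r opprK leNgt; apply/negP => t0.
  apply: infeas; exists (t^-1 *: x) => i.
  by rewrite scalar_formZ// mulrC ler_pdivrMr// -subr_le0.
exists w; split=> // [x|].
  have := gE (x, 0); rewrite /= mulr0 subr0 => E; rewrite [RHS]E.
  by apply: eq_bigr => i _; rewrite mulr0 subr0.
have := gE (0, 1); rewrite /=.
have -> : \sum_i w i * (f i 0 - b i * 1) = - \sum_i w i * b i.
  by rewrite -sumrN; apply: eq_bigr => i _; rewrite scalar_form0//; ring.
by lra.
Qed.

End Farkas.

(** * Interval systems and images of polyhedra *)

Section Dot.
Variable R : comPzRingType.

Definition dot d (x y : 'cV[R]_d) : R := (x^T *m y) 0 0.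

Lemma dotE d (x y : 'cV[R]_d) : dot x y = \sum_i x i 0 * y i 0.
Proof. by rewrite /dot mxE; apply: eq_bigr => i _; rewrite mxE. Qed.

Lemma dotC d (x y : 'cV[R]_d) : dot x y = dot y x.
Proof. by rewrite !dotE; apply: eq_bigr => i _; rewrite mulrC. Qed.

Lemma dot_scalar d (x : 'cV[R]_d) : scalar (dot x).
Proof. by move=> t y z; rewrite /dot linearP/= !mxE. Qed.

Lemma dotDr d (x y z : 'cV[R]_d) : dot x (y + z) = dot x y + dot x z.
Proof. exact/scalar_formD/dot_scalar. Qed.

Lemma dotNr d (x y : 'cV[R]_d) : dot x (- y) = - dot x y.
Proof. exact/scalar_formN/dot_scalar. Qed.

Lemma dotZr d t (x y : 'cV[R]_d) : dot x (t *: y) = t * dot x y.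
Proof. exact/scalar_formZ/dot_scalar. Qed.

Lemma dot0r d (x : 'cV[R]_d) : dot x 0 = 0.
Proof. exact/scalar_form0/dot_scalar. Qed.

Lemma dotDl d (x y z : 'cV[R]_d) : dot (x + y) z = dot x z + dot y z.
Proof. by rewrite dotC dotDr !(dotC z). Qed.

Lemma dotNl d (x y : 'cV[R]_d) : dot (- x) y = - dot x y.
Proof. by rewrite dotC dotNr dotC. Qed.

Lemma dotZl d t (x y : 'cV[R]_d) : dot (t *: x) y = t * dot x y.
Proof. by rewrite dotC dotZr dotC. Qed.

Lemma dot0l d (x : 'cV[R]_d) : dot 0 x = 0.
Proof. by rewrite dotC dot0r. Qed.

Lemma dot_sumr d (I : finType) (x : 'cV[R]_d) (f : I -> 'cV[R]_d) :
  dot x (\sum_i f i) = \sum_i dot x (f i).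
Proof.
by elim/big_ind2: _ => [|y y' z z' <- <-|//]; rewrite ?dot0r// dotDr.
Qed.

Lemma dot_suml d (I : finType) (x : 'cV[R]_d) (f : I -> 'cV[R]_d) :
  dot (\sum_i f i) x = \sum_i dot (f i) x.
Proof. by rewrite dotC dot_sumr; apply: eq_bigr => i _; rewrite dotC. Qed.

Lemma dot_mulmx m n (A : 'M[R]_(m, n)) x y : dot x (A *m y) = dot (A^T *m x) y.
Proof. by rewrite /dot trmx_mul trmxK mulmxA. Qed.

Lemma dot_delta d (x : 'cV[R]_d) i : dot x (delta_mx i 0) = x i 0.
Proof.
rewrite dotE (bigD1 i)//= mxE !eqxx mulr1 big1 ?addr0// => j ji.
by rewrite mxE (negPf ji) mulr0.
Qed.

Lemma dot_inj d (x y : 'cV[R]_d) : (forall z, dot x z = dot y z) -> x = y.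
Proof.
by move=> xy; apply/matrixP => i j; rewrite ord1 -!dot_delta xy.
Qed.

End Dot.

Section IntervalSystems.
Variables (R : realType) (V : lmodType R) (J : finType) (g : J -> V -> R).
Variables (lo hi : J -> \bar R).

(** An infinite bound contributes the zero form. As [fine] sends infinities to 0, its inequality
    becomes [0 <= 0]. *)
Definition interval_form (k : J + J) (x : V) : R :=
  match k with
  | inl j => if hi j \is a fin_num then g j x else 0
  | inr j => if lo j \is a fin_num then - g j x else 0
  end.

Definition interval_bound (k : J + J) : R :=
  match k with inl j => fine (hi j) | inr j => - fine (lo j) end.

Hypothesis lin_g : forall j, scalar (g j).
Hypothesis lo_ltey : forall j, lo j != +oo%E.
Hypothesis hi_gtNye : forall j, hi j != -oo%E.

Lemma interval_form_scalar k : scalar (interval_form k).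
Proof.
by case: k => j t x y /=; case: ifP => _; rewrite ?mulr0 ?addr0// lin_g; ring.
Qed.

Lemma interval_systemP x :
  (forall j, (lo j <= (g j x)%:E <= hi j)%E) <->
  (forall k, interval_form k x <= interval_bound k).
Proof.
split=> [gx [j|j] /=|gx j].
- have /andP[_] := gx j; have := hi_gtNye j.
  by case: (hi j) => //= r _; rewrite lee_fin.
- have /andP[+ _] := gx j; have := lo_ltey j.
  by case: (lo j) => //= r _; rewrite lee_fin lerN2.
- have := gx (inl j); have := gx (inr j) => /=.
  have := hi_gtNye j; have := lo_ltey j.
  case: (lo j) => [r||]//=; case: (hi j) => [r'||]//=;
    by rewrite ?lee_fin ?lerN2 ?leNye ?leey => _ _ // -> //; rewrite andbT.
Qed.

(** The multipliers [p j] and [q j] of the upper and lower bound merge into the signed weight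
    [p j - q j]. Cancelling their common part changes the cost by
    [- min (p j) (q j) * (hi j - lo j)], which does not increase it. *)
Lemma interval_farkas (h : V -> R) (r : R) (x0 : V) :
  scalar h -> (forall j, (lo j <= (g j x0)%:E <= hi j)%E) ->
  (forall x, (forall j, (lo j <= (g j x)%:E <= hi j)%E) -> h x <= r) ->
  exists w : J -> R,
    [/\ forall x, h x = \sum_j w j * g j x,
        forall j, hi j \isn't a fin_num -> w j <= 0,
        forall j, lo j \isn't a fin_num -> 0 <= w j
      & \sum_j (fine (hi j) * Num.max 0 (w j)
                - fine (lo j) * Num.max (- w j) 0) <= r].
Proof.
move=> lin_h gx0 gh.
have [||||w [w0 hE wr]] := @affine_farkas R V _ interval_form interval_bound
    h r x0.
- exact: interval_form_scalar.
- exact: lin_h.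
- exact/interval_systemP.
- by move=> x /interval_systemP; exact: gh.
pose p j := if hi j \is a fin_num then w (inl j) else 0.
pose q j := if lo j \is a fin_num then w (inr j) else 0.
have p0 j : 0 <= p j by rewrite /p; case: ifP.
have q0 j : 0 <= q j by rewrite /q; case: ifP.
exists (fun j => p j - q j); split.
- move=> x; rewrite hE big_sumType/= -big_split/=; apply: eq_bigr => j _.
  by rewrite /p /q; do 2 case: ifP => _; ring.
- by move=> j /negPf fj; rewrite /p fj sub0r oppr_le0.
- by move=> j /negPf fj; rewrite /q fj subr0.
apply: le_trans wr; rewrite big_sumType/= -big_split/=; apply: ler_sum => j _.
have -> : w (inl j) * fine (hi j) = p j * fine (hi j).
  by rewrite /p; case: (hi j) => //=; rewrite mulr0 mul0r.
have -> : w (inr j) * - fine (lo j) = - (q j * fine (lo j)).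
  by rewrite mulrN /q; case: (lo j) => //=; rewrite mulr0 mul0r.
(* If both multipliers are nonzero, both bounds are finite, and the feasible [x0] orders them. *)
have le_lohi : p j * q j != 0 -> fine (lo j) <= fine (hi j).
  rewrite mulf_eq0 negb_or /p /q.
  case: ifP; rewrite ?eqxx// => fh; case: ifP; rewrite ?eqxx ?andbF// => fl _.
  by rewrite -lee_fin !fineK//; have /andP[] := gx0 j; exact: le_trans.
have [pq0|/le_lohi] := eqVneq (p j * q j) 0.
  move/eqP: pq0; rewrite mulf_eq0 => /orP[]/eqP ->.
    rewrite sub0r opprK (max_l (_ : - q j <= 0)) ?oppr_le0// max_l//; lra.
  by rewrite subr0 max_r// max_r ?oppr_le0//; lra.
have [pq|/ltW pq] := leP (q j) (p j).
  rewrite max_r ?subr_ge0// max_r ?oppr_le0 ?subr_ge0// => lh.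
  rewrite mulr0 subr0 -subr_ge0.
  have -> : p j * fine (hi j) - q j * fine (lo j) - fine (hi j) * (p j - q j) =
    (fine (hi j) - fine (lo j)) * q j by ring.
  by rewrite mulr_ge0// subr_ge0.
rewrite max_l ?subr_le0// max_l ?oppr_ge0 ?subr_le0// => lh.
rewrite mulr0 -subr_ge0.
have -> : p j * fine (hi j) - q j * fine (lo j)
    - (0 - fine (lo j) * - (p j - q j)) =
  (fine (hi j) - fine (lo j)) * p j by ring.
by rewrite mulr_ge0// subr_ge0.
Qed.

End IntervalSystems.

(* The Farkas certificate for the infeasibility of the fibre over [y] provides
   the separating functional. *)
Lemma polyhedron_image_separation (R : realFieldType) (V : lmodType R)
    (I : finType) (f : I -> V -> R) (b : I -> R) d (L : V -> 'cV[R]_d) y :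
  (forall i, scalar (f i)) -> (forall i, scalar (fun x => L x i 0)) ->
  ~ (exists2 x, (forall i, f i x <= b i) & L x = y) ->
  exists (w : 'cV[R]_d) (r : R),
    (forall x, (forall i, f i x <= b i) -> dot w (L x) <= r) /\ r < dot w y.
Proof.
move=> lin_f lin_L infeas.
pose F (k : I + ('I_d + 'I_d)) x := match k with
  | inl i => f i x | inr (inl i) => L x i 0 | inr (inr i) => - L x i 0 end.
pose b' (k : I + ('I_d + 'I_d)) := match k with
  | inl i => b i | inr (inl i) => y i 0 | inr (inr i) => - y i 0 end.
have [||w [w0 wF wb]] := @farkas_infeasible R V _ F b'.
- case=> [i|[i|i]]; [exact: lin_f|exact: lin_L|].
  by move=> t x z /=; rewrite lin_L opprD mulrN.
- move=> [x Fx]; apply: infeas; exists x => [i|]; first exact: (Fx (inl i)).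
  apply/matrixP => i j; rewrite ord1; apply/le_anti/andP; split.
    exact: (Fx (inr (inl i))).
  by rewrite -lerN2; exact: (Fx (inr (inr i))).
(* Each equation of [L x = y] was split into two inequalities; their multipliers recombine, with the
   sign that makes [dot u (L x)] equal to the combination of the [f i x]. *)
pose u : 'cV[R]_d := \col_i (w (inr (inr i)) - w (inr (inl i))).
have uE z : dot u z = \sum_i w (inr (inr i)) * z i 0
    - \sum_i w (inr (inl i)) * z i 0.
  by rewrite dotE -sumrB; apply: eq_bigr => i _; rewrite mxE mulrBl.
exists u, (\sum_i w (inl i) * b i); split=> [x fx|].
  have := wF x; rewrite !big_sumType/= => E.
  have -> : dot u (L x) = \sum_i w (inl i) * f i x.
    rewrite uE; have : \sum_i w (inr (inr i)) * - L x i 0 =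
        - \sum_i w (inr (inr i)) * L x i 0.
      by rewrite -sumrN; apply: eq_bigr => i _; rewrite mulrN.
    by move=> E'; rewrite E' in E; lra.
  by apply: ler_sum => i _; rewrite ler_wpM2l.
move: wb; rewrite !big_sumType/= uE.
have -> : \sum_i w (inr (inr i)) * - y i 0 = - \sum_i w (inr (inr i)) * y i 0.
  by rewrite -sumrN; apply: eq_bigr => i _; rewrite mulrN.
lra.
Qed.

(** * Duality for linear programs with interval constraints *)

Section LinearProgram.
Variables (R : realType) (m n : nat) (B : 'M[R]_(m, n)).
Variables (a b : 'cV[\bar R]_m) (l s : 'cV[\bar R]_n).
Hypothesis a_ltey : forall i, a i 0 != +oo%E.
Hypothesis b_gtNye : forall i, b i 0 != -oo%E.
Hypothesis l_ltey : forall j, l j 0 != +oo%E.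
Hypothesis s_gtNye : forall j, s j 0 != -oo%E.

Lemma edot_le d (x z : 'cV[R]_d) (t : 'cV[\bar R]_d) : nonneg_vec z ->
  (forall i, (t i ord0 <= (x i ord0)%:E)%E) -> (edot t z <= (dot x z)%:E)%E.
Proof.
move=> z0 tx; rewrite dotE -sumEFin; apply: lee_sum => i _.
by rewrite EFinM lee_wpmul2r// lee_fin.
Qed.

Lemma edot_ge d (x z : 'cV[R]_d) (t : 'cV[\bar R]_d) : nonneg_vec z ->
  (forall i, ((x i ord0)%:E <= t i ord0)%E) -> ((dot x z)%:E <= edot t z)%E.
Proof.
move=> z0 tx; rewrite dotE -sumEFin; apply: lee_sum => i _.
by rewrite EFinM lee_wpmul2r// lee_fin.
Qed.

Lemma edot_fine d (t : 'cV[\bar R]_d) (z : 'cV[R]_d) :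
  (forall i, t i 0 \isn't a fin_num -> z i 0 = 0) ->
  edot t z = (\sum_i fine (t i ord0) * z i 0)%:E.
Proof.
move=> tz; rewrite -sumEFin; apply: eq_bigr => i _.
have [ti|/tz ->] := boolP (t i 0 \is a fin_num); last by rewrite mule0 mulr0.
by rewrite EFinM fineK.
Qed.

Lemma pos_part_ge0 d (x : 'cV[R]_d) : nonneg_vec (pos_part x).
Proof. by move=> i; rewrite mxE le_max lexx. Qed.

Lemma neg_part_ge0 d (x : 'cV[R]_d) : nonneg_vec (neg_part x).
Proof. by move=> i; rewrite mxE le_max lexx orbT. Qed.

Lemma pos_part_sub d (x : 'cV[R]_d) : pos_part x - neg_part x = x.
Proof.
apply/matrixP => i j; rewrite !mxE.
by case: (leP 0 (x i j)) => x0;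
  [rewrite (max_r (_ : - _ <= _)) ?subr0 ?oppr_le0
  |rewrite max_l ?sub0r ?opprK// oppr_ge0 ltW].
Qed.

Lemma dual_cost_ge x u v : primal_feasible B a b l s x ->
  ((dot u (B *m x) - dot v x)%:E <= dual_cost a b l s u v)%E.
Proof.
move=> [abx lsx].
have -> : dot u (B *m x) - dot v x = dot (B *m x) (pos_part u)
   - dot (B *m x) (neg_part u) + dot x (neg_part v) - dot x (pos_part v).
  rewrite -(dotNr _ (neg_part u)) -dotDr pos_part_sub -addrA; congr (_ + _).
    by rewrite dotC.
  by rewrite -[RHS]opprK opprB -(dotNr _ (neg_part v)) -dotDr pos_part_sub dotC.
rewrite !EFinB EFinD EFinB leeB//; last first.
  by apply: edot_le => [|j]; [exact: pos_part_ge0|case/andP: (lsx j)].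
rewrite leeD//; last first.
  by apply: edot_ge => [|j]; [exact: neg_part_ge0|case/andP: (lsx j)].
by rewrite leeB//; [apply: edot_ge => [|j]|apply: edot_le => [|j]];
  [exact: pos_part_ge0|case/andP: (abx j)|exact: neg_part_ge0|
   case/andP: (abx j)].
Qed.

(** The Farkas weights of the rows of [B] form [u], the negated weights of the box constraints form
    [v]. The sign conditions at infinite bounds make the corresponding products vanish, so the cost
    is finite. *)
Lemma strong_duality (h : 'cV[R]_n) (r : R) x0 : primal_feasible B a b l s x0 ->
  (forall x, primal_feasible B a b l s x -> dot h x <= r) ->
  exists u v, [/\ B^T *m u = h + v, dual_cost a b l s u v \is a fin_num
    & fine (dual_cost a b l s u v) <= r].
Proof.
move=> Sx0 hr.
pose g (k : 'I_m + 'I_n) (x : 'cV[R]_n) : R :=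
  match k with inl i => (B *m x) i 0 | inr j => x j 0 end.
pose lo (k : 'I_m + 'I_n) := match k with inl i => a i 0 | inr j => l j 0 end.
pose hi (k : 'I_m + 'I_n) := match k with inl i => b i 0 | inr j => s j 0 end.
have feasE x : primal_feasible B a b l s x <->
    forall k, (lo k <= (g k x)%:E <= hi k)%E.
  split=> [[abx lsx] [i|j]|H]; [exact: abx|exact: lsx|].
  by split=> [i|j]; [exact: (H (inl i))|exact: (H (inr j))].
have [||||||w [hE w_hi w_lo wr]] := @interval_farkas R _ _ g lo hi _ _ _
    (dot h) r x0.
- by move=> [i|j] t x y /=; rewrite ?linearP/= !mxE.
- by case.
- by case.
- exact: dot_scalar.
- exact/feasE.
- by move=> x /feasE; exact: hr.
pose u : 'cV[R]_m := \col_i w (inl i).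
pose v : 'cV[R]_n := \col_j - w (inr j).
have uvE : B^T *m u = h + v.
  apply: dot_inj => x; rewrite dotDl -dot_mulmx hE big_sumType/= !dotE -addrA.
  rewrite -big_split/= [X in _ + X]big1 ?addr0 => [|j _].
    by apply: eq_bigr => i _; rewrite !mxE.
  by rewrite mxE; ring.
have costE : dual_cost a b l s u v =
   (\sum_j (fine (hi j) * Num.max 0 (w j)
            - fine (lo j) * Num.max (- w j) 0))%:E.
  rewrite /dual_cost !edot_fine.
  - rewrite -!EFinB; congr _%:E => /=.
    rewrite big_sumType/= -!sumrB -addrA -[X in _ + X]sumrB.
    congr (_ + _); apply: eq_bigr => i _; rewrite !mxE//.
    by rewrite opprK maxC (maxC 0 (- _)).
  - by move=> j /(w_lo (inr j)) wj; rewrite !mxE max_l// oppr_le0.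
  - by move=> j /(w_hi (inr j)) wj; rewrite !mxE opprK max_r.
  - by move=> i /(w_lo (inl i)) wi; rewrite !mxE max_r// oppr_le0.
  - by move=> i /(w_hi (inl i)) wi; rewrite !mxE max_l.
by exists u, v; split=> //; rewrite costE.
Qed.

(** The lower image is the image of a polyhedron of pairs [(x, k)], with [k >= 0] the cone
    coordinates, under the linear map [P *m x - Y *m k]. *)
Lemma lower_image_separation q o (P : 'M[R]_(q, n)) (Y : 'M[R]_(q, o)) y :
  ~ lower_image P B a b l s (cone_of Y) y ->
  exists (w : 'cV[R]_q) (r : R),
    (forall z, lower_image P B a b l s (cone_of Y) z -> dot w z <= r) /\
    r < dot w y.
Proof.
move=> nPy.
pose V : lmodType R := ('cV[R]_n * 'cV[R]_o)%type.
pose g (k : 'I_m + 'I_n + 'I_o) (z : V) : R :=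
  match k with inl (inl i) => (B *m z.1) i 0 | inl (inr j) => z.1 j 0
  | inr i => z.2 i 0 end.
pose lo (k : 'I_m + 'I_n + 'I_o) :=
  match k with inl (inl i) => a i 0 | inl (inr j) => l j 0 | inr _ => 0%E end.
pose hi (k : 'I_m + 'I_n + 'I_o) :=
  match k with inl (inl i) => b i 0 | inl (inr j) => s j 0 | inr _ => +oo%E end.
have feasE x k : (forall i, (lo i <= (g i (x, k))%:E <= hi i)%E) <->
    primal_feasible B a b l s x /\ nonneg_vec k.
  split=> [H|[[abx lsx] k0] [[i|j]|i]].
  - split; first by split=> [i|j]; [exact: (H (inl (inl i)))
                                   |exact: (H (inl (inr j)))].
    by move=> i; have /andP[] := H (inr i); rewrite lee_fin.
  - exact: abx.
  - exact: lsx.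
  - by rewrite /= lee_fin k0 leey.
have lin_g k : scalar (g k).
  by move: k => [[i|j]|i] t x z /=; rewrite ?linearP/= !mxE.
have lo' k : lo k != +oo%E by case: k => [[]|].
have hi' k : hi k != -oo%E by case: k => [[]|].
have [|||w [r [wr ry]]] := @polyhedron_image_separation R V _
    (interval_form g lo hi) (interval_bound lo hi) q
    (fun z => P *m z.1 - Y *m z.2) y.
- exact: interval_form_scalar.
- by move=> i t [x k] [x' k'] /=; rewrite !linearP/= !mxE; ring.
- move=> [[x k]] /interval_systemP-/(_ lo' hi')/feasE[Sx k0] yE; apply: nPy.
  by exists x => //; exists (Y *m k) => //; exists k.
exists w, r; split=> // _ [x Sx [_ [k k0 <-] <-]].
by apply: (wr (x, k)); apply/interval_systemP => //; exact/feasE.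
Qed.

End LinearProgram.

(** * Convex and conic hulls *)

Lemma finite_set_range (T : choiceType) (A : set T) : finite_set A ->
  exists k (p : 'I_k -> T), A = range p.
Proof.
move=> /finite_seqP[t ->]; exists (size t), (tnth (in_tuple t)).
apply/seteqP; split=> [x xt|x [i _ <-]].
  by have /tnthP[i ->] : x \in in_tuple t by []; exists i.
exact: mem_tnth.
Qed.

Section Hulls.
Variables (R : realType) (d : nat).
Implicit Types (A : set 'cV[R]_d) (x w : 'cV[R]_d).

Lemma sub_convex_hull A : A `<=` convex_hull A.
Proof.
move=> x Ax; exists 1%N, (fun=> x), (fun=> 1); split=> //.
  by rewrite big_ord1.
by rewrite big_ord1 scale1r.
Qed.

Lemma conic_hull0 A : conic_hull A 0.
Proof.
by exists 0%N, (fun=> 0), (fun=> 0); split=> //; [case|rewrite big_ord0].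
Qed.

Lemma conic_hull_cons A x y t : conic_hull A x -> A y -> 0 <= t ->
  conic_hull A (t *: y + x).
Proof.
move=> [k [p [u [Ap u0 ->]]]] Ay t0.
exists k.+1, (fun i => if unlift ord0 i is Some j then p j else y),
  (fun i => if unlift ord0 i is Some j then u j else t); split.
- by move=> i; case: unlift.
- by move=> i; case: unlift.
- rewrite big_ord_recl unlift_none; congr (_ + _).
  by apply: eq_bigr => i _; rewrite liftK.
Qed.

Lemma conic_hull_set1 x y :
  conic_hull [set x] y -> exists2 t, 0 <= t & y = t *: x.
Proof.
move=> [k [p [t [px t0 ->]]]]; exists (\sum_i t i); first exact: sumr_ge0.
by rewrite scaler_suml; apply: eq_bigr => i _; rewrite px.
Qed.

Lemma conic_hull_set0 x : conic_hull set0 x -> x = 0.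
Proof.
by move=> [[|k] [p [t [px t0 ->]]]]; [rewrite big_ord0|case: (px ord0)].
Qed.

Lemma dot_convex_hull A w r x : (forall y, A y -> dot w y <= r) ->
  convex_hull A x -> dot w x <= r.
Proof.
move=> wA [k [p [t [Ap t0 t1 ->]]]]; rewrite -[r]mul1r -t1 mulr_suml dot_sumr.
by apply: ler_sum => i _; rewrite dotZr ler_wpM2l ?wA.
Qed.

Lemma dot_conic_hull A w x : (forall y, A y -> dot w y <= 0) ->
  conic_hull A x -> dot w x <= 0.
Proof.
move=> wA [k [p [t [Ap t0 ->]]]]; rewrite dot_sumr.
by apply: sumr_le0 => i _; rewrite dotZr mulr_ge0_le0 ?wA.
Qed.

(** [x] is the midpoint of [x + z] and [x - z]. *)
Lemma vertex_symm (Q : set 'cV[R]_d) x z :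
  is_vertex Q x -> Q (x + z) -> Q (x - z) -> z = 0.
Proof.
move=> [_ vx] Qxz Qxz'; have [||] := vx _ _ (2^-1) Qxz Qxz'.
- by apply/andP; split; lra.
- by apply/matrixP => i j; rewrite !mxE; field.
- by move=> + _ => /(canRL (addKr _)); rewrite addNr.
Qed.

End Hulls.

(** Extracts inequalities for recession directions from inequalities for points on a ray. *)
Lemma slope_le0 (R : realFieldType) (x y r : R) :
  (forall t, 0 <= t -> x + t * y <= r) -> y <= 0.
Proof.
move=> H; rewrite leNgt; apply/negP => y0.
have /H : 0 <= (`|r - x| + 1) / y by rewrite divr_ge0 ?(ltW y0) ?addr_ge0.
by rewrite divfK ?gt_eqF//; have := ler_norm (r - x); lra.
Qed.

(** For small [t > 0] the point [c - t *: w] stays in [C], whence [dot c w >= t * dot w w > 0]. *)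
Lemma interior_dot_gt0 (R : realType) d (C : set 'cV[R]_d.+1) c w :
  interior C c -> (forall k, C k -> 0 <= dot w k) -> w != 0 -> 0 < dot c w.
Proof.
move=> Cc wC w0.
have ww : 0 < dot w w.
  rewrite lt_neqAle dotE sumr_ge0 ?andbT => [|i _]; last exact: sqr_ge0.
  apply: contra w0 => /eqP/esym/eqP; rewrite psumr_eq0 => [|i _]; last first.
    exact: sqr_ge0.
  move=> /allP ww; apply/eqP/matrixP => i j; rewrite ord1 mxE.
  by have := ww i (mem_index_enum i); rewrite mulf_eq0 orbb => /eqP.
have cvg_c : (fun t : R => c - t *: w) @ (0 : R) --> c.
  suff : (fun t : R => c - t *: w) @ (0 : R) --> c - 0 *: w.
    by rewrite scale0r subr0.
  by apply: cvgB; [exact: cvg_cst|apply: cvgZr_tmp; exact: cvg_id].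
have /nbhs_ballP[e /= e0 eC] := cvg_c _ Cc.
have /eC/= /wC : ball (0 : R) e (e / 2).
  by rewrite /ball/= sub0r normrN gtr0_norm; lra.
rewrite dotDr dotNr dotZr (dotC w c) subr_ge0; apply: lt_le_trans.
by rewrite mulr_gt0// divr_gt0.
Qed.

(** * Dual coordinates *)

Section Coordinates.
Variables (R : realType) (q : nat) (c : 'cV[R]_q.+1).
Hypothesis cq_neq0 : c ord_max 0 != 0.
Implicit Types (w y ys : 'cV[R]_q.+1) (r : R).

Let sg := c ord_max 0 / `|c ord_max 0|.

(** The value of [dual_objective] at a dual solution of weight [w] and cost [r]. *)
Definition dual_point w r : 'cV[R]_q.+1 :=
  \col_i if i == ord_max then r else c ord_max 0 / `|c ord_max 0| * w i 0.

(* The last entry is chosen so that [dot c (normal ys) = 1]. *)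
Definition normal ys : 'cV[R]_q.+1 :=
  \col_i if i == ord_max then
      (1 - \sum_(j | j != ord_max) c j 0 * (sg * ys j 0)) / c ord_max 0
    else sg * ys i 0.

Lemma sgM : sg * sg = 1.
Proof.
by rewrite /sg mulf_div -normrM -expr2 ger0_norm ?sqr_ge0// divff// expf_neq0.
Qed.

Lemma dot_last x y :
  dot x y = x ord_max 0 * y ord_max 0 + \sum_(i | i != ord_max) x i 0 * y i 0.
Proof. by rewrite dotE (bigD1 ord_max). Qed.

Lemma dot_normal ys : dot c (normal ys) = 1.
Proof.
rewrite dot_last mxE eqxx.
rewrite [X in _ + X](eq_bigr (fun j => c j 0 * (sg * ys j 0)))
  => [|i /negPf ni].
  by field.
by rewrite mxE ni.
Qed.

(** [dual_point] forgets the last coordinate of [w], which the normalization determines because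
    [c_q] is nonzero. *)
Lemma dual_pointK w r : dot c w = 1 -> normal (dual_point w r) = w.
Proof.
move=> cw; apply/matrixP => i j; rewrite ord1 mxE.
case: eqP => [->|/eqP/negPf ni].
  rewrite (eq_bigr (fun j => c j 0 * w j 0)) => [|k /negPf nk].
    by move: cw; rewrite dot_last => <-; field.
  by rewrite mxE nk -/sg [sg * _]mulrA sgM mul1r.
by rewrite mxE ni -/sg mulrA sgM mul1r.
Qed.

Lemma dual_point_last w r : dual_point w r ord_max 0 = r.
Proof. by rewrite mxE eqxx. Qed.

Lemma normalK ys : dual_point (normal ys) (ys ord_max 0) = ys.
Proof.
apply/matrixP => i j; rewrite ord1 mxE; case: eqP => [-> //|/eqP/negPf ni].
by rewrite mxE ni -/sg mulrA sgM mul1r.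
Qed.

Lemma phiE (g : generator 'cV[R]_q.+1) ys : phi c g ys =
  `|c ord_max 0| * (xi R g * ys ord_max 0 - dot (normal ys) (gval g)).
Proof.
rewrite /phi dot_last mxE eqxx.
under [X in _ - (_ + X)]eq_bigr => i /negPf ni.
  by rewrite mxE ni -/sg mulrAC -mulrA; over.
under [X in (1 - X) / _]eq_bigr => i _.
  by rewrite mulrCA; over.
rewrite -!mulr_sumr.
have nE : `|c ord_max 0| * sg = c ord_max 0.
  by rewrite mulrC divfK// normr_eq0.
have nV : `|c ord_max 0| / c ord_max 0 = sg.
  apply/(canLR (mulfK cq_neq0)).
  by rewrite /sg mulrAC -expr2 -real_normK ?num_real// expr2 mulfK// normr_eq0.
move: (\sum_(i | _) _ * _) (\sum_(i | _) _ * _) => T S.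
(* Factors are inserted using [|c_q| * sg = c_q] and [sg * sg = 1], so that the remaining identity
   holds with [sg] replaced by an arbitrary constant. *)
transitivity (- (`|c ord_max 0| * sg) * S -
   gval g ord_max 0 * (`|c ord_max 0| / c ord_max 0
     - (sg * (`|c ord_max 0| / c ord_max 0)) * T)
   + xi R g * `|c ord_max 0| * ys ord_max 0).
  by rewrite nE nV sgM mul1r.
move: sg => e; by field.
Qed.

Lemma phi_ge0 (g : generator 'cV[R]_q.+1) ys : (0 <= phi c g ys) =
  (dot (normal ys) (gval g) <= xi R g * ys ord_max 0).
Proof. by rewrite phiE pmulr_rge0 ?normr_gt0// subr_ge0. Qed.

Lemma phi_affine_dual (g : generator 'cV[R]_q.+1) : affine_fun (phi c g).
Proof.
pose cq := c ord_max 0; pose y := gval g.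
exists (\col_i if i == ord_max then xi R g * `|cq|
               else y ord_max 0 * c i 0 - cq * y i 0),
  (- (y ord_max 0 * (`|cq| / cq))) => ys.
rewrite -/(dot _ _) dot_last mxE eqxx.
rewrite (eq_bigr (fun i => y ord_max 0 * (c i 0 * ys i 0)
    - cq * (y i 0 * ys i 0))) => [|i /negPf ni]; last by rewrite mxE ni; ring.
by rewrite sumrB -!mulr_sumr /phi -/y -/cq; ring.
Qed.

Lemma phi_affine_primal ys : affine_fun (fun y => phi c (Point y) ys).
Proof.
exists (- `|c ord_max 0| *: normal ys), (`|c ord_max 0| * ys ord_max 0) => y.
by rewrite -/(dot _ _) dotZl phiE /= mul1r; ring.
Qed.

(** [dual_point] is linear in the pair [(w, r)], so combinations of dual points are combinations of
    normals and of bounds. *)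
Lemma dual_point_sum k (p : 'I_k -> 'cV[R]_q.+1) (t : 'I_k -> R) r :
  \sum_i t i *: p i + r *: delta_mx ord_max 0 =
  dual_point (\sum_i t i *: normal (p i)) (\sum_i t i * p i ord_max 0 + r).
Proof.
apply/matrixP => i j; rewrite ord1 !mxE !summxE andbT.
case: eqP => [->|/eqP/negPf ni].
  by rewrite mulr1; congr (_ + _); apply: eq_bigr => k' _; rewrite mxE.
rewrite mulr0 addr0 mulr_sumr; apply: eq_bigr => k' _.
by rewrite !mxE ni -/sg mulrCA (mulrA sg sg) sgM mul1r.
Qed.

Lemma dot_normal_sum k (p : 'I_k -> 'cV[R]_q.+1) (t : 'I_k -> R) :
  dot c (\sum_i t i *: normal (p i)) = \sum_i t i.
Proof.
by rewrite dot_sumr; apply: eq_bigr => i _; rewrite dotZr dot_normal mulr1.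
Qed.

End Coordinates.

(** * Geometric duality *)

Section GeometricDuality.
Variables (R : realType) (q : nat) (c : 'cV[R]_q.+1).
Hypothesis cq_neq0 : c ord_max 0 != 0.
Variables (P D : set 'cV[R]_q.+1) (y0 : 'cV[R]_q.+1).
(** The duality is isolated from the linear programs: [upper_imageP], [lower_imageP] and
    [lower_bounded_normal] will supply these hypotheses. *)
Hypothesis D_P : forall ys, D ys <->
  forall y, P y -> dot (normal c ys) y <= ys ord_max 0.
Hypothesis P_D : forall y, P y <->
  forall ys, D ys -> dot (normal c ys) y <= ys ord_max 0.
Hypothesis bounded_normal : forall w r, (forall y, P y -> dot w y <= r) ->
  w != 0 -> 0 < dot c w.
Hypothesis y0_vertex : is_vertex P y0.

Lemma dual_point_D w r : dot c w = 1 ->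
  D (dual_point c w r) <-> forall y, P y -> dot w y <= r.
Proof. by move=> cw; rewrite D_P dual_pointK// dual_point_last. Qed.

(** Otherwise [P] would be the whole space, which has no vertex. *)
Lemma D_nonempty : D !=set0.
Proof.
apply/set0P/negP => /eqP D0.
have PT y : P y by apply/P_D; rewrite D0.
have /matrixP/(_ ord0 0)/eqP :=
  vertex_symm y0_vertex (PT _) (PT (_ - delta_mx ord0 0)).
by rewrite !mxE !eqxx oner_eq0.
Qed.

(* Were all normals equal, [P] would be a half-space, which has no vertex
   when [0 < q]. *)
Lemma normal_nonconstant w : (0 < q)%N ->
  ~ forall ys, D ys -> normal c ys = w.
Proof.
move=> q_gt0 Dw.
(* Since [0 < q], the first and last coordinates differ, and the plane they span contains a nonzero
   vector orthogonal to [w]. *)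
have [z z0 wz] : exists2 z : 'cV[R]_q.+1, z != 0 & dot w z = 0.
  have neq0 : (ord0 == ord_max :> 'I_q.+1) = false.
    by rewrite -val_eqE/= eq_sym; case: (q) q_gt0.
  have [w00|w00] := eqVneq (w ord0 0) 0.
    exists (delta_mx ord0 0); last by rewrite dot_delta.
    apply/eqP => /matrixP/(_ ord0 0)/eqP.
    by rewrite !mxE !eqxx oner_eq0.
  exists (w ord_max 0 *: delta_mx ord0 0 - w ord0 0 *: delta_mx ord_max 0).
    apply/eqP => /matrixP/(_ ord_max 0)/eqP.
    rewrite !mxE !eqxx [ord_max == ord0]eq_sym neq0 mulr0 sub0r mulr1.
    by rewrite oppr_eq0 (negPf w00).
  by rewrite dotDr dotNr !dotZr !dot_delta mulrC subrr.
have [Py0 _] := y0_vertex.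
apply/negP: z0; rewrite negbK; apply/eqP.
by apply: (vertex_symm y0_vertex); apply/P_D => ys Dys;
  rewrite dotDr ?dotNr (Dw _ Dys) wz ?oppr0 addr0 -(Dw _ Dys);
  exact: (P_D _).1.
Qed.

Lemma Vrep_iff_Hrep (G : set (generator 'cV[R]_q.+1)) :
  (0 < q)%N -> finite_set G -> Vrep G P <-> Hrep G (phi c) D.
Proof.
move=> q_gt0 finG; split=> [[_ PE]|[_ _ DE]].
  split=> //; first by move=> g _; exact: phi_affine_dual.
  apply/seteqP; split=> [ys Dys g Gg|ys /= Gys].
    rewrite phi_ge0//; have /D_P Pys := Dys.
    case: g Gg => [y|d] Gg /=; rewrite ?mul1r ?mul0r.
      apply: Pys; rewrite PE; exists y; first exact: sub_convex_hull.
      by exists 0; [exact: conic_hull0|rewrite addr0].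
    (* From a point of [P], the ray in direction [d] stays in [P], so the form is bounded along
       it. *)
    have [+ _] := y0_vertex; rewrite PE => -[x Gx [k Gk _]].
    apply: (@slope_le0 _ (dot (normal c ys) (x + k)) _ (ys ord_max 0)) => t t0.
    rewrite -dotZr -dotDr -addrA [k + _]addrC; apply: Pys; rewrite PE.
    exists x => //; exists (t *: d + k) => //; exact: conic_hull_cons.
  apply/D_P => y; rewrite PE => -[x Gx [k Gk <-]].
  rewrite dotDr -[leRHS]addr0 lerD//.
    apply: dot_convex_hull Gx => z Gz.
    by have := Gys _ Gz; rewrite phi_ge0//= mul1r.
  apply: dot_conic_hull Gk => z Gz.
  by have := Gys _ Gz; rewrite phi_ge0//= mul0r.
(* The polar of the cone generated by the homogenized generators [(y, 1)] and [(d, 0)]. The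
   H-representation describes only its slice [dot c w = 1]; [polarP] extends validity on [P] to the
   whole cone. *)
pose polar w r := forall g, G g -> dot w (gval g) <= xi R g * r.
have D_polar w r : dot c w = 1 -> D (dual_point c w r) <-> polar w r.
  move=> cw; rewrite DE; split=> H g Gg; have := H g Gg;
  by rewrite phi_ge0// dual_pointK// dual_point_last.
have polar1 w r : dot c w = 1 -> polar w r -> forall y, P y -> dot w y <= r.
  by move=> cw /(D_polar _ _ cw)/(dual_point_D _ cw).
have polarD w r w' r' t : polar w r -> polar w' r' -> 0 <= t ->
    polar (w + t *: w') (r + t * r').
  move=> wr wr' t0 g Gg; rewrite dotDl dotZl mulrDr lerD ?wr//.
  by rewrite mulrCA ler_wpM2l// wr'.
have [ys0 Dys0] := D_nonempty.
have polar_ys0 : polar (normal c ys0) (ys0 ord_max 0).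
  by apply/D_polar; rewrite ?normalK// dot_normal.
(* Adding any multiple [t >= 0] of [(w, r)] to a point of the slice stays in the slice, so the slope
   in [t] must be nonpositive. *)
have polar0 w r : dot c w = 0 -> polar w r -> forall y, P y -> dot w y <= r.
  move=> cw wr y Py; rewrite -subr_le0.
  apply: (@slope_le0 _ (dot (normal c ys0) y) _ (ys0 ord_max 0)) => t t0.
  have := polar1 _ _ _ (polarD _ _ _ _ _ polar_ys0 wr t0) y Py.
  rewrite dotDr dot_normal// dotZr cw mulr0 addr0 => /(_ erefl).
  by rewrite dotDl dotZl; lra.
have polarP w r : polar w r -> forall y, P y -> dot w y <= r.
  move=> wr y Py; case: (ltrgtP (dot c w) 0) => cw; last exact: (polar0 w r).
  - exfalso; have t0 : 0 < (- dot c w)^-1 by rewrite invr_gt0 oppr_gt0.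
    (* A rescaled [w] added to any normal gives [w'] with [dot c w' = 0], bounded on [P] by
       [polar0]. Then [bounded_normal] forces [w' = 0], so all normals would coincide. *)
    apply: (@normal_nonconstant (- ((- dot c w)^-1 *: w)) q_gt0) => ys Dys.
    have polar_ys : polar (normal c ys) (ys ord_max 0).
      by apply/D_polar; rewrite ?normalK// dot_normal.
    have := polarD _ _ _ _ _ polar_ys wr (ltW t0).
    set w' := _ + _; set r' := _ + _ => wr'.
    have cw' : dot c w' = 0.
      by rewrite dotDr dot_normal// dotZr; field; rewrite lt_eqF.
    have [/eqP|w'0] := eqVneq w' 0; first by rewrite addr_eq0 => /eqP.
    by have := bounded_normal (polar0 _ _ cw' wr') w'0; rewrite cw' ltxx.
  - have t0 : 0 <= (dot c w)^-1 by rewrite invr_ge0 ltW.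
    have polar00 : polar 0 0 by move=> g _; rewrite dot0l mulr0.
    have := polar1 _ _ _ (polarD _ _ _ _ _ polar00 wr t0) y Py.
    rewrite !add0r dotZr mulVf ?gt_eqF// => /(_ erefl).
    by rewrite dotZl ler_pM2l// invr_gt0.
have [k1 [p pE]] : exists k (p : 'I_k -> 'cV[R]_q.+1),
    [set y | G (Point y)] = range p.
  by apply/finite_set_range/finite_preimage => // x y _ _ [].
have [k2 [d dE]] : exists k (d : 'I_k -> 'cV[R]_q.+1),
    [set y | G (Direction y)] = range d.
  by apply/finite_set_range/finite_preimage => // x y _ _ [].
have Gp i : G (Point (p i)).
  by have : range p (p i) by []; rewrite -pE.
have Gd i : G (Direction (d i)).
  by have : range d (d i) by []; rewrite -dE.
split=> //; apply/seteqP; split=> [y Py|_ [x Gx [k Gk <-]]]; last first.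
  apply/P_D => ys; rewrite DE dotDr => Gys; rewrite -[leRHS]addr0 lerD//.
    apply: dot_convex_hull Gx => z Gz.
    by have := Gys _ Gz; rewrite phi_ge0//= mul1r.
  apply: dot_conic_hull Gk => z Gz.
  by have := Gys _ Gz; rewrite phi_ge0//= mul0r.
(* Farkas now writes [(y, 1)] as a nonnegative combination of homogenized generators. Evaluation at
   [(0, 1)] shows that the point weights sum to 1, and evaluation at [(z, 0)] recovers [y]. *)
pose f (i : 'I_k1 + 'I_k2) (z : 'cV[R]_q.+1 * R^o) : R := match i with
  inl i => dot (p i) z.1 - 1 * z.2 | inr i => dot (d i) z.1 - 0 * z.2 end.
have [|||t t0 yE] := @farkas R _ _ f (fun z => dot y z.1 - 1 * z.2).
- by case=> i; apply: scalar_pair; exact: dot_scalar.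
- by apply: scalar_pair; exact: dot_scalar.
- move=> [w r] fwr /=; rewrite mul1r subr_le0 dotC; apply: polarP Py => g.
  case: g => z Gz /=; rewrite ?mul1r ?mul0r.
    have [i _ <-] : range p z by rewrite -pE.
    by have := fwr (inl i); rewrite /= mul1r subr_le0 dotC.
  have [i _ <-] : range d z by rewrite -dE.
  by have := fwr (inr i); rewrite /= mul0r subr0 dotC.
exists (\sum_i t (inl i) *: p i).
  exists k1, p, (t \o inl); split=> //=.
  have := yE (0, 1); rewrite big_sumType/= dot0r.
  rewrite [X in _ = _ + X]big1 => [|i _]; last by rewrite dot0r; ring.
  rewrite (eq_bigr (fun i => - t (inl i))) => [|i _]; last first.
    by rewrite dot0r; ring.
  by rewrite sumrN; lra.
exists (\sum_i t (inr i) *: d i).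
  by exists k2, d, (t \o inr); split=> //=.
apply: dot_inj => z; have := yE (z, 0); rewrite big_sumType/= mulr0 subr0 => ->.
by rewrite dotDl !dot_suml; congr (_ + _); apply: eq_bigr => i _;
  rewrite dotZl ?mul0r ?subr0.
Qed.

Lemma dot_normal_hull (W : set 'cV[R]_q.+1) y ys t :
  (forall z, W z -> dot (normal c z) y <= z ord_max 0) -> 0 <= t ->
  convex_hull W ys -> let ys' := ys + t *: delta_mx ord_max 0 in
  dot (normal c ys') y <= ys' ord_max 0.
Proof.
move=> Wy t0 [k [p [u [Wp u0 u1 ->]]]] /=.
rewrite (dual_point_sum cq_neq0) dual_pointK ?dot_normal_sum// dual_point_last.
rewrite dot_suml -[leLHS]addr0 lerD//; apply: ler_sum => i _.
by rewrite dotZl ler_wpM2l// Wy.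
Qed.

Let vertical : set (generator 'cV[R]_q.+1) :=
  [set Direction (delta_mx ord_max 0)].

(** For the converse, each point of [D] is an inequality valid on [P]; affine Farkas derives it from
    those of [W]. Pairing the normals with [c] shows that the weights sum to 1. *)
Lemma Vrep_vertical_iff_Hrep (W : set 'cV[R]_q.+1) : finite_set W ->
  Vrep (@Point _ @` W `|` vertical) D <->
  Hrep W (fun ys y => phi c (Point y) ys) P.
Proof.
move=> finW; rewrite /Vrep.
have -> : [set y | (@Point _ @` W `|` vertical) (Point y)] = W.
  apply/seteqP; split=> [y [[z Wz [<-]]|] //|y Wy]; left; by exists y.
have -> : [set y | (@Point _ @` W `|` vertical) (Direction y)] =
    [set delta_mx ord_max 0].
  by apply/seteqP; split=> [y [[z Wz]|[]] //|y ->]; right.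
have finG : finite_set (@Point _ @` W `|` vertical).
  by rewrite finite_setU; split; [exact: finite_image|exact: finite_set1].
split=> [[_ DE]|[_ _ PE]].
  split=> //; first by move=> ys _; exact: phi_affine_primal.
  apply/seteqP; split=> [y /P_D Py ys Wys|y /= Wy].
    rewrite phi_ge0//= mul1r; apply: Py; rewrite DE.
    exists ys; first exact: sub_convex_hull.
    by exists 0; [exact: conic_hull0|rewrite addr0].
  apply/P_D => ys'; rewrite DE => -[ys Wys [k /conic_hull_set1[t t0 ->] <-]].
  apply: dot_normal_hull Wys => // z Wz.
  by have := Wy _ Wz; rewrite phi_ge0//= mul1r.
have Wle y : P y -> forall z, W z -> dot (normal c z) y <= z ord_max 0.
  by rewrite PE => Wy z Wz; have := Wy _ Wz; rewrite phi_ge0//= mul1r.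
split=> //; apply/seteqP; split=> [ys Dys|ys' [ys Wys [k]]]; last first.
  move=> /conic_hull_set1[t t0 ->] <-; apply/D_P => y /Wle Wy.
  exact: dot_normal_hull Wys.
have [k [p pE]] := finite_set_range finW.
have Wp i : W (p i) by rewrite pE.
have [Py0 _] := y0_vertex.
have [||||t [t0 tE tle]] := @affine_farkas R _ _ (fun i => dot (normal c (p i)))
   (fun i => p i ord_max 0) (dot (normal c ys)) (ys ord_max 0) y0.
- by move=> i; exact: dot_scalar.
- exact: dot_scalar.
- by move=> i; exact: Wle.
- move=> y Wy; apply: (P_D y).1 Dys; rewrite PE => z Wz.
  rewrite phi_ge0//= mul1r; move: Wz; rewrite pE => -[i _ <-]; exact: Wy.
have nE : \sum_i t i *: normal c (p i) = normal c ys.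
  apply: dot_inj => z; rewrite tE dot_suml.
  by apply: eq_bigr => i _; rewrite dotZl.
exists (\sum_i t i *: p i).
  exists k, p, t; split=> //.
  by rewrite -(dot_normal_sum cq_neq0 p) nE dot_normal.
(* The slack of the Farkas bound becomes the vertical component. *)
pose e := ys ord_max 0 - \sum_i t i * p i ord_max 0.
exists (e *: delta_mx ord_max 0 + 0).
  by apply: conic_hull_cons => //; [exact: conic_hull0|rewrite subr_ge0].
by rewrite addr0 (dual_point_sum cq_neq0) nE /e addrC subrK normalK.
Qed.

(** The last coordinate is bounded on the hull of finitely many points, but not on [D], where it can
    always be increased. *)
Lemma not_Vrep_bounded (W : set 'cV[R]_q.+1) : finite_set W ->
  ~ Vrep (@Point _ @` W) D.
Proof.
move=> /finite_set_range[k [p ->]] [_ DE].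
have [ys0 Dys0] := D_nonempty.
pose M := \sum_i `|p i ord_max 0| + 1 + `|ys0 ord_max 0|.
have D_le ys : D ys -> ys ord_max 0 <= \sum_i `|p i ord_max 0|.
  rewrite DE => -[x Wx [d + <-]].
  have -> : [set y | (@Point _ @` range p) (Direction y)] = set0.
    by apply/seteqP; split=> // y [].
  move=> /conic_hull_set0 ->; rewrite addr0 -[leLHS]dot_delta dotC.
  apply: dot_convex_hull Wx => _ [_ [i _ <-] [<-]].
  rewrite dotC dot_delta (bigD1 i)//= (le_trans (ler_norm _))// lerDl.
  exact: sumr_ge0.
have : D (dual_point c (normal c ys0) M).
  apply/dual_point_D; first exact: dot_normal.
  move=> y Py; apply: le_trans ((D_P ys0).1 Dys0 y Py) _.
  rewrite /M (le_trans (ler_norm _))// lerDr addr_ge0//; exact: sumr_ge0.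
by move=> /D_le; rewrite dual_point_last /M;
  have := normr_ge0 (ys0 ord_max 0); lra.
Qed.

Lemma irredundant_Vrep_iff_Hrep (G : set (generator 'cV[R]_q.+1)) :
  (0 < q)%N -> finite_set G ->
  irredundant_Vrep G P <-> irredundant_Hrep G (phi c) D.
Proof.
move=> q_gt0 finG; rewrite /irredundant_Vrep /irredundant_Hrep.
have finD g : finite_set (G `\ g) by exact: finite_setD.
split=> -[/(Vrep_iff_Hrep q_gt0 finG) rep H];
  by split=> // g Gg /(Vrep_iff_Hrep q_gt0 (finD g)); exact: H.
Qed.

(** Omitting a point matches omitting its inequality; the vertical direction can never be omitted,
    by [not_Vrep_bounded]. *)
Lemma irredundant_Vrep_vertical_iff_Hrep (W : set 'cV[R]_q.+1) :
  finite_set W ->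
  irredundant_Vrep (@Point _ @` W `|` vertical) D <->
  irredundant_Hrep W (fun ys y => phi c (Point y) ys) P.
Proof.
move=> finW; rewrite /irredundant_Vrep /irredundant_Hrep.
have rmE y : (@Point _ @` W `|` vertical) `\ Point y =
    @Point _ @` (W `\ y) `|` vertical.
  apply/seteqP; split=> [g [[[z Wz <-] gy|-> _]]|g [[z [Wz zy] <-]|->]].
  - by left; exists z => //; split=> // zy; apply: gy; rewrite zy.
  - by right.
  - by split; [left; exists z|case].
  - by split; [right|].
have finD y : finite_set (W `\ y) by exact: finite_setD.
split=> -[/(Vrep_vertical_iff_Hrep finW) rep H]; split=> //.
  move=> y Wy /(Vrep_vertical_iff_Hrep (finD y)); rewrite -rmE.
  by apply: H; left; exists y.
move=> _ [[y Wy <-]|->].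
  by rewrite rmE => /(Vrep_vertical_iff_Hrep (finD y)); exact: H.
have -> : (@Point _ @` W `|` vertical) `\ Direction (delta_mx ord_max 0) =
    @Point _ @` W.
  apply/seteqP; split=> [g [[//|-> /(_ erefl)//]]|g Wg]; split; first by left.
  by case: Wg => z _ <-.
exact: not_Vrep_bounded.
Qed.

End GeometricDuality.

(** * The vector linear program *)

Section VectorLinearProgram.
Variables (R : realType) (n m q o : nat).
Variables (Y : 'M[R]_(q.+1, o)) (c : 'cV[R]_q.+1).
Variables (P : 'M[R]_(q.+1, n)) (B : 'M[R]_(m, n)).
Variables (a b : 'cV[\bar R]_m) (l s : 'cV[\bar R]_n).
Hypothesis c_interior : interior (cone_of Y) c.
Hypothesis cq_neq0 : c ord_max 0 != 0.
Hypothesis a_ltey : forall i, a i 0 != +oo%E.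
Hypothesis b_gtNye : forall i, b i 0 != -oo%E.
Hypothesis l_ltey : forall j, l j 0 != +oo%E.
Hypothesis s_gtNye : forall j, s j 0 != -oo%E.

Let lower := lower_image P B a b l s (cone_of Y).
Let upper := upper_image P B a b l s Y c.

Variable y0 : 'cV[R]_q.+1.
Hypothesis lower_y0 : lower y0.

Lemma cone_of0 : cone_of Y 0.
Proof. by exists 0; [move=> i; rewrite mxE|rewrite mulmx0]. Qed.

(** Subtracting multiples of [k] from [y0] stays in the lower image, so [dot w (- k)] is a slope
    bounded by [slope_le0]. *)
Lemma lower_bounded_dual_cone w r : (forall y, lower y -> dot w y <= r) ->
  forall k, cone_of Y k -> 0 <= dot w k.
Proof.
move=> wr _ [v v0 <-]; rewrite -oppr_le0.
case: lower_y0 => x Sx [_ [v' v'0 <-] y0E].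
apply: (@slope_le0 _ (dot w y0) _ r) => t t0.
rewrite -dotNr -dotZr -dotDr; apply: wr.
exists x => //; exists (Y *m (v' + t *: v)).
  by exists (v' + t *: v) => // i; rewrite !mxE addr_ge0// mulr_ge0.
by rewrite -y0E mulmxDr -scalemxAr opprD scalerN addrA.
Qed.

Lemma lower_bounded_normal w r : (forall y, lower y -> dot w y <= r) ->
  w != 0 -> 0 < dot c w.
Proof.
move=> /lower_bounded_dual_cone wC; exact: interior_dot_gt0 c_interior wC.
Qed.

(** Weak duality gives one direction. For the other, strong duality applied to maximizing
    [dot (P^T *m w) x], with [w] the normal of [ys], produces a dual solution of cost at most the
    last coordinate of [ys]. *)
Lemma upper_imageP ys : upper ys <->
  forall y, lower y -> dot (normal c ys) y <= ys ord_max 0.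
Proof.
split=> [[[[u w] v] [uv Yw cw cost_fin] [k [k0 klast] <-]] _
    [x Sx [_ [z z0 <-] <-]]|ysP].
  have -> : dual_objective a b l s c (u, w, v) + k =
      dual_point c w (fine (dual_cost a b l s u v) + k ord_max 0).
    apply/matrixP => i j; rewrite ord1 !mxE.
    by case: eqP => [->//|/eqP/k0 ->]; rewrite addr0.
  rewrite dual_pointK// dual_point_last dotDr dotNr.
  have : dot w (P *m x) <= fine (dual_cost a b l s u v).
    rewrite -lee_fin fineK// dot_mulmx -[P^T *m w](addrK v) -uv dotDl dotNl.
    by rewrite -dot_mulmx; exact: dual_cost_ge.
  have : 0 <= dot w (Y *m z).
    rewrite dot_mulmx dotE; apply: sumr_ge0 => i _; exact: mulr_ge0.
  by lra.
pose w := normal c ys.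
have [x0 Sx0 _] := lower_y0.
have [|u [v [uv cost_fin cost_le]]] := strong_duality a_ltey b_gtNye l_ltey
    s_gtNye (h := P^T *m w) (r := ys ord_max 0) Sx0.
  move=> x Sx; rewrite -dot_mulmx; apply: ysP.
  by exists x => //; exists 0; [exact: cone_of0|rewrite subr0].
exists (u, w, v).
  split=> //; last exact: dot_normal.
  (* The entries of [Y^T *m w] are the values of [w] on the columns of [Y], which lie in the
     cone. *)
  move=> i; rewrite -dot_delta -dot_mulmx.
  apply: (lower_bounded_dual_cone ysP); exists (delta_mx i 0) => // j.
  by rewrite mxE ler0n.
exists (ys - dual_objective a b l s c (u, w, v)); last by rewrite addrC subrK.
split=> [i|]; last by rewrite !mxE eqxx subr_ge0.
rewrite -[ys in ys - _](normalK cq_neq0) !mxE => /negPf ->.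
by rewrite subrr.
Qed.

(** A functional separating [y] is positive at the interior point [c], so it rescales to a
    normalized one, whose dual point lies in the upper image and excludes [y]. *)
Lemma lower_imageP y : lower y <->
  forall ys, upper ys -> dot (normal c ys) y <= ys ord_max 0.
Proof.
split=> [Py ys /upper_imageP|yP]; first exact.
apply: contrapT => /lower_image_separation-/(_ a_ltey b_gtNye l_ltey s_gtNye).
move=> [w [r [wr ry]]].
(* A zero functional cannot separate strictly, as the lower image contains [y0]. *)
have w0 : w != 0.
  apply/eqP => w0; have := wr _ lower_y0; move: ry; rewrite w0 !dot0l => ry.
  by rewrite leNgt ry.
have cw := lower_bounded_normal wr w0.
pose w' := (dot c w)^-1 *: w.
have cw' : dot c w' = 1 by rewrite dotZr mulVf ?gt_eqF.
have : upper (dual_point c w' (r / dot c w)).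
  apply/upper_imageP => z Pz; rewrite dual_pointK// dual_point_last dotZl.
  by rewrite mulrC ler_pM2r ?invr_gt0// wr.
move=> /yP; rewrite dual_pointK// dual_point_last dotZl mulrC.
by rewrite ler_pM2r ?invr_gt0// leNgt ry.
Qed.

End VectorLinearProgram.

Unset Implicit Arguments.

(* The number of objectives is q.+1.  The restriction 1 < q.+1 in the first
   part is needed: with a single objective, the inequality coming from the
   recession direction of the lower image is the trivial one 0 <= 1, so the
   system is never irredundant.  *)
Theorem theorem12 (R : realType) (n m q o : nat)
    (C : set 'cV[R]_q.+1) (Y : 'M[R]_(q.+1, o.+1)) (c : 'cV[R]_q.+1)
    (P : 'M[R]_(q.+1, n.+1)) (B : 'M[R]_(m.+1, n.+1))
    (a b : 'cV[\bar R]_m.+1) (l s : 'cV[\bar R]_n.+1)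
    (hC : C = cone_of Y) (hlines : contains_no_line C)
    (hc : (interior C) c) (hcq : c ord_max 0 != 0)
    (ha : forall i, a i 0 != +oo%E) (hb : forall i, b i 0 != -oo%E)
    (hl : forall j, l j 0 != +oo%E) (hs : forall j, s j 0 != -oo%E)
    (hvertex : exists y, is_vertex (lower_image P B a b l s C) y) :
  ((1 < q.+1)%N ->
   forall Ybar : set (generator 'cV[R]_q.+1), finite_set Ybar ->
     (irredundant_Vrep Ybar (lower_image P B a b l s C) <->
      irredundant_Hrep Ybar (fun y ys => phi c y ys)
        (upper_image P B a b l s Y c)))
  /\
  (forall Wbar : set 'cV[R]_q.+1, finite_set Wbar ->
     (irredundant_Vrep
        (@Point 'cV[R]_q.+1 @` Wbar `|`
           [set @Direction 'cV[R]_q.+1 (delta_mx ord_max 0)])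
        (upper_image P B a b l s Y c) <->
      irredundant_Hrep Wbar (fun ys y => phi c (Point y) ys)
        (lower_image P B a b l s C))).
Proof.
subst C; case: hvertex => y0 y0_vertex; have [lower_y0 _] := y0_vertex.
have D_P := upper_imageP hcq ha hb hl hs lower_y0.
have P_D := lower_imageP hc hcq ha hb hl hs lower_y0.
have bounded w r := lower_bounded_normal hc lower_y0 (w := w) (r := r).
split=> [q_gt0 G finG|W finW].
  exact: (irredundant_Vrep_iff_Hrep hcq D_P P_D bounded y0_vertex).
exact: (irredundant_Vrep_vertical_iff_Hrep hcq D_P P_D y0_vertex).
Qed.
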